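(* Let $f_1,f_2\in L_2(\Omega)$ satisfy $f_1\le f_2$ a.e. in $\Omega$, and let $\psi\in H^{1/2}(\Gamma_N)$. For $i=1,2$ let $u_i\in\mathcal V_{0,D}$ be a solution of $$(\kappa(x,u_i)\nabla u_i,\nabla v)=(f_i,v)+\int_{\Gamma_N}\psi v\quad\text{for all } v\in\mathcal V_{0,D}.$$ Suppose that for every triangle $T\in\mathcal T$, with vertices $a_1,a_2,a_3$, $$\gamma_T^{-1}(1+\gamma_T^{-1})\max_{i',j'\in\{1,2,3\}}|u_2(a_{i'})-u_2(a_{j'})|<\frac{6k_\alpha c_T}{7L_0}.$$ Then $u_1\le u_2$ in $\Omega$.
   Context: $\Omega\subset\mathbb R^2$ is an open bounded polygonal domain with boundary $\partial\Omega=\Gamma_D\cup\Gamma_N$, where $\Gamma_D$ has positive measure and $\Gamma_N=\partial\Omega\setminus\Gamma_D$. $\mathcal T$ is a conforming triangulation of $\Omega$ by triangles that exactly captures $\partial\Omega$ and each of $\Gamma_D$ and $\Gamma_N$. Mesh regularity: there are numbers $0<t_{\min}<t_{\max}$ such that the interior angles $\theta_1,\theta_2,\theta_3$ of every $T\in\mathcal T$ satisfy $t_{\min}\le\theta_i\le t_{\max}<\pi/2$, $i=1,2,3$. For $T\in\mathcal T$ with interior angles $\theta_1,\theta_2,\theta_3$ set $$\gamma_T=\min_{i,j\in\{1,2,3\}}\frac{\sin\theta_i}{\sin\theta_j},\qquad c_T=\min_{i=1,2,3}\cos\theta_i .$$ $\mathcal V_{0,D}$ is the space of continuous functions on $\overline\Omega$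 that are affine on each $T\in\mathcal T$ and vanish on $\Gamma_D$. $(\cdot,\cdot)$ is the $L_2(\Omega)$ inner product (of scalar or vector functions). The coefficient $\kappa:\Omega\times\mathbb R\to\mathbb R$ is a Carathéodory function (measurable in $x$ for each $s$, continuous in $s$ for a.e. $x$). There are constants $0<k_\alpha<k_\beta$ with $k_\alpha<\kappa(x,s)<k_\beta$ for all $s\in\mathbb R$ and a.e. $x\in\Omega$, and a constant $L_0>0$ with $|\kappa(x,s)-\kappa(x,t)|\le L_0|s-t|$ for all $s,t\in\mathbb R$ and a.e. $x\in\Omega$. The discrete equation is the finite element weak form of $-\mathrm{div}(\kappa(x,u)\nabla u)=f$ in $\Omega$ with $u=0$ on $\Gamma_D$ and $\kappa(x,u)\nabla u^T\boldsymbol n=\psi$ on $\Gamma_N$, where $\boldsymbol n$ is the outward normal. *)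

(* Defs.v *)
From mathcomp Require Import all_boot all_order all_algebra.
From mathcomp Require Import all_classical all_reals all_analysis.

Set Implicit Arguments.
Unset Strict Implicit.
Unset Printing Implicit Defensive.

Import Order.TTheory GRing.Theory Num.Theory.
Import numFieldNormedType.Exports.

Local Open Scope classical_set_scope.
Local Open Scope ring_scope.

(* The norm that R * R inherits as a product is the sup norm, so Euclidean
   lengths go through dot. *)

(* R and R * R with the sigma-algebra of Lebesgue measurable sets (the one of
   completed_lebesgue_measure, resp. leb2) instead of the Borel one. *)
Notation lebR R := (caratheodory_type (@wlength R idfun)^*%mu).
Notation lebR2 R := (caratheodory_type
  (@lebesgue_measure R \x @lebesgue_measure R)%E^*%mu).

Section Plane.
Context {R : realType}.
Implicit Types (x y p q : R * R) (u : R * R -> R) (A : set (R * R)).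

Definition dot x y : R := x.1 * y.1 + x.2 * y.2.
Definition enorm x : R := Num.sqrt (dot x x).

Definition seg_pt p q (s : R) : R * R := p + s *: (q - p).
Definition segment p q : set (R * R) := seg_pt p q @` `[0, 1].
Definition open_segment p q : set (R * R) := seg_pt p q @` `]0, 1[.

Definition boundary A : set (R * R) := closure A `\` A°.

Definition grad u x : R * R := ('D_(1, 0) u x, 'D_(0, 1) u x).

Definition leb2 :=
  @completed_measure_extension _ (measurableTypeR R * measurableTypeR R)%type R
    (@lebesgue_measure R \x @lebesgue_measure R)%E.

Definition L2 A u : Prop := u \_ A \in Lfun leb2 2%:E.

(* The condition (closure A)° = A excludes slits and removed points: along each
   boundary segment A lies on one side only, so that the outward normal makes
   sense. *)
Definition polygonal_domain A : Prop :=
  [/\ open A, bounded_set A, connected A, (closure A)° = A &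
      exists m (p q : 'I_m -> R * R),
        (forall k, p k != q k) /\
        boundary A = \bigcup_k segment (p k) (q k)].

(* A triangle is given by its vertices a 0, a 1, a 2; indices are added
   modulo 3. *)
Implicit Types a : 'I_3 -> R * R.

Definition triangle a : set (R * R) :=
  [set x | exists l : 'I_3 -> R,
     [/\ forall i, 0 <= l i, \sum_i l i = 1 & x = \sum_i l i *: a i]].

Definition nondegenerate a : Prop :=
  let b := a 1 - a 0 in let c := a 2 - a 0 in b.1 * c.2 - b.2 * c.1 != 0.

Definition angle a (i : 'I_3) : R :=
  let b := a (i + 1) - a i in let c := a (i + 2) - a i in
  acos (dot b c / (enorm b * enorm c)).

(* The default value 1 is the ratio for i = j, hence is attained. *)
Definition gammaT a : R :=
  \big[Num.min/1]_(i < 3) \big[Num.min/1]_(j < 3)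
    (sin (angle a i) / sin (angle a j)).

Definition cT a : R :=
  \big[Num.min/cos (angle a 0)]_(i < 3) cos (angle a i).

Definition max_jump a u : R :=
  \big[Num.max/0]_(i < 3) \big[Num.max/0]_(j < 3) `|u (a i) - u (a j)|.

Definition affine_on A u : Prop :=
  exists (c : R) (g : R * R), forall x, A x -> u x = c + dot g x.

End Plane.

Section Mesh.
Context {R : realType} {n : nat}.
Variable T : 'I_n -> 'I_3 -> R * R.
Implicit Types (A G GD GN : set (R * R)) (f u v psi : R * R -> R) (k l : 'I_n).

Definition edge k (i : 'I_3) : set (R * R) := segment (T k i) (T k (i + 1)).
Definition open_edge k (i : 'I_3) : set (R * R) :=
  open_segment (T k i) (T k (i + 1)).
Definition edge_pt k (i : 'I_3) (s : R) : R * R :=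
  seg_pt (T k i) (T k (i + 1)) s.
Definition edge_length k (i : 'I_3) : R := enorm (T k (i + 1) - T k i).

(* Two distinct triangles are disjoint, or meet in exactly one common vertex,
   or meet in exactly one common edge. *)
Definition conforming_triangulation A : Prop :=
  [/\ forall k, nondegenerate (T k),
      closure A = \bigcup_k triangle (T k) &
      forall k l, k != l ->
        let I := triangle (T k) `&` triangle (T l) in
        [\/ I = set0,
            exists i j, T k i = T l j /\ I = [set T k i] |
            exists i j, edge k i = edge l j /\ I = edge k i]].

(* G is a union of mesh edges, up to the endpoints of the edges. *)
Definition captures G : Prop :=
  forall x, G x -> exists k i, edge k i x /\ open_edge k i `<=` G.

Definition boundary_edge A k (i : 'I_3) : bool := `[< edge k i `<=` boundary A >].

(* Arc length integral over a part G of the boundary of A, by parametrization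
   of the boundary edges. When A is a polygonal domain triangulated by T, a
   boundary edge is an edge of exactly one triangle, so that it is counted
   once. *)
Definition arc_integral A G (g : R * R -> \bar R) : \bar R :=
  (\sum_(k < n) \sum_(i < 3 | boundary_edge A k i)
     (edge_length k i)%:E *
     \int[@completed_lebesgue_measure R]_(s in `[0%R, 1%R])
       (g \_ G) (edge_pt k i s))%E.

Definition arc_measurable A G psi : Prop :=
  forall k i, boundary_edge A k i ->
    measurable_fun (`[0, 1] : set (lebR R))
      ((psi \_ G) \o edge_pt k i : lebR R -> R).

(* Sobolev-Slobodeckij definition of H^(1/2) on a one-dimensional set: the
   exponent of |x - y| is 1 + 2 * (1/2). *)
Definition H12 A G psi : Prop :=
  [/\ arc_measurable A G psi,
      (arc_integral A G (fun x => ((psi x) ^+ 2)%:E) < +oo)%E &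
      (arc_integral A G (fun x => arc_integral A G (fun y =>
         ((psi x - psi y) ^+ 2 / enorm (x - y) ^+ 2)%:E)) < +oo)%E].

(* Functions are total on the plane; only their values on closure A matter. *)
Definition V0D A GD : set (R * R -> R) :=
  [set v | [/\ {within closure A, continuous v},
               forall k, affine_on (triangle (T k)) v &
               forall x, GD x -> v x = 0]].

Definition discrete_solution A GD GN (kappa : R * R -> R -> R) f psi u : Prop :=
  V0D A GD u /\
  forall v, V0D A GD v ->
    \int[leb2]_(x in A) (kappa x (u x) * dot (grad u x) (grad v x)) =
    \int[leb2]_(x in A) (f x * v x) +
    fine (arc_integral A GN (fun x => (psi x * v x)%:E)).

End Mesh.

Definition caratheodory_function {R : realType} (A : set (R * R))
    (kappa : R * R -> R -> R) : Prop :=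
  (forall s, measurable_fun (A : set (lebR2 R)) (kappa ^~ s : lebR2 R -> R)) /\
  {ae leb2, forall x, A x -> continuous (kappa x)}.

(* Main.v *)
Require Import Defs.
From mathcomp Require Import all_boot all_order all_algebra.
From mathcomp Require Import ring lra.
From mathcomp Require Import all_classical all_reals all_analysis measurable_realfun.
Import Order.TTheory GRing.Theory Num.Theory.
Import numFieldNormedType.Exports.

Set Implicit Arguments.
Unset Strict Implicit.
Unset Printing Implicit Defensive.

Local Open Scope classical_set_scope.
Local Open Scope ring_scope.

(* With w = u1 - u2, let v be the finite element function that is 1 at the nodes
   where w > 0 and 0 at the other nodes.  It vanishes on GammaD, and testing both
   equations with it cancels the Neumann terms:
     int (kappa(u1) grad u1 - kappa(u2) grad u2) . grad v = int (f1 - f2) v <= 0.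
   On a triangle where w has one sign at the nodes, grad v = 0.  On any other
   triangle the vertex p at which w has the odd sign satisfies, up to the factor
   4 |T|^2,
     grad w . grad v = |w_p - w_q| dr + |w_p - w_r| dq,
   with dq, dr the products of adjacent side lengths with cosines at q and r,
   while |w| <= |w_p - w_q| + |w_p - w_r| pointwise; the mesh condition then
   makes the integrand pointwise positive.  Hence no such triangle exists, v is
   constant on the connected domain, and it is 0 because of GammaD. *)

Local Notation nondegenerate := Defs.nondegenerate.

(** * Vertex indices modulo 3 *)

Lemma ord3P (i : 'I_3) : [\/ i = 0, i = 1 | i = 2].
Proof.
by case: i => [[|[|[|//]]] p]; [apply: Or31|apply: Or32|apply: Or33];
  apply: val_inj.
Qed.

Lemma big_ord3 (V : nmodType) (F : 'I_3 -> V) :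
  \sum_i F i = F 0 + F 1 + F 2.
Proof.
rewrite !big_ord_recl big_ord0 addr0 addrA.
by congr (F _ + F _ + F _); apply: val_inj.
Qed.

(** The addition table of ['I_3], bundled as one multi-rule for [rewrite]. *)
Definition ord3_add :=
  let E (i j k : 'I_3) (H : val (i + j) = val k) : i + j = k := val_inj H in
  (E 0 1 1 erefl, E 0 2 2 erefl, E 1 1 2 erefl,
   E 1 2 0 erefl, E 2 1 0 erefl, E 2 2 1 erefl).

Lemma ord3_next (i : 'I_3) :
  [/\ i + 1 + 1 = i + 2, i + 1 + 2 = i, i + 2 + 1 = i & i + 2 + 2 = i + 1].
Proof. by case: (ord3P i) => ->; rewrite !ord3_add. Qed.

(** * Barycentric coordinates, triangles and segments *)

Section Geometry.
Context {R : realType}.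
Implicit Types (x y p q g h : R * R) (a : 'I_3 -> R * R) (i j k : 'I_3)
  (u : R * R -> R).

Definition det2 x y : R := x.1 * y.2 - x.2 * y.1.

(** Twice the signed area; the sign records the orientation of the vertices. *)
Definition area2 a : R := det2 (a 1 - a 0) (a 2 - a 0).

(** Quotient of signed areas: the numerator has [x] in place of vertex [i], so the orientation
    cancels. *)
Definition bary a i x : R := det2 (a (i + 1) - x) (a (i + 2) - x) / area2 a.

Definition open_triangle a : set (R * R) := [set x | forall i, 0 < bary a i x].

Lemma nondegenerateP a : nondegenerate a -> area2 a != 0.
Proof. by []. Qed.

(** The only term of the determinant quadratic in [x] is [det2 x x], which vanishes. *)
Lemma bary_affine a i : exists c g, forall x, bary a i x = c + dot g x.
Proof.
pose p := a (i + 1); pose q := a (i + 2).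
exists (det2 p q / area2 a), ((p.2 - q.2) / area2 a, (q.1 - p.1) / area2 a) => x.
by rewrite /bary /dot /det2 /p /q /=; ring.
Qed.

Lemma sum_bary a x : nondegenerate a -> \sum_i bary a i x = 1.
Proof.
move=> /nondegenerateP; rewrite big_ord3 /bary !ord3_add /area2 /det2 /= => D.
by field.
Qed.

Lemma bary_vertex a i j : nondegenerate a -> bary a i (a j) = (i == j)%:R.
Proof.
move=> /nondegenerateP; rewrite /bary /area2 /det2.
by case: (ord3P i) => ->; case: (ord3P j) => ->; rewrite !ord3_add /= => D;
  field.
Qed.

Lemma sum_bary_vertex a x : nondegenerate a -> \sum_i bary a i x *: a i = x.
Proof.
move=> /nondegenerateP; rewrite big_ord3 /bary !ord3_add /area2 /det2 /= => D.
by rewrite [RHS]surjective_pairing; congr pair => /=;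
  rewrite /GRing.scale /=; field.
Qed.

Lemma affine_sum (c : R) g (l : 'I_3 -> R) a : \sum_i l i = 1 ->
  c + dot g (\sum_i l i *: a i) = \sum_i l i * (c + dot g (a i)).
Proof.
rewrite !big_ord3 /dot /= /GRing.scale /= => l1.
by rewrite -[c in LHS]mulr1 -l1; ring.
Qed.

Lemma affine_bary a (c : R) g x : nondegenerate a ->
  c + dot g x = \sum_i bary a i x * (c + dot g (a i)).
Proof.
by move=> nda; rewrite -affine_sum ?sum_bary// sum_bary_vertex.
Qed.

(** Affine functions commute with convex combinations, and [bary a i] is 1 at vertex [i] and 0 at
    the others; hence it reads off the [i]-th coefficient. *)
Lemma triangleP a x : nondegenerate a ->
  triangle a x <-> forall i, 0 <= bary a i x.
Proof.
move=> nda; split=> [[l [l0 l1 ->]] i|x0]; last first.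
  by exists (bary a ^~ x); rewrite sum_bary// sum_bary_vertex.
suff -> : bary a i (\sum_i l i *: a i) = l i by [].
have [c [g bE]] := bary_affine a i.
rewrite bE affine_sum// (bigD1 i)//= -bE bary_vertex// eqxx mulr1 big1 ?addr0//.
by move=> j ji; rewrite -bE bary_vertex// eq_sym (negbTE ji) mulr0.
Qed.

Lemma continuous_affine (c : R) g : continuous (fun x => c + dot g x).
Proof.
move=> x; apply: cvgD; first exact: cvg_cst.
by apply: cvgD; (apply: cvgM; first exact: cvg_cst);
  [exact: cvg_fst|exact: cvg_snd].
Qed.

Lemma continuous_bary a i : continuous (bary a i).
Proof.
have [c [g bE]] := bary_affine a i; rewrite (funext bE).
exact: continuous_affine.
Qed.

Lemma open_open_triangle a : open (open_triangle a).
Proof.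
pose P i := bary a i @^-1` [set r | 0 < r].
have oP i : open (P i).
  by apply: open_comp => [x _|]; [exact: continuous_bary|exact: open_gt].
have -> : open_triangle a = P 0 `&` P 1 `&` P 2.
  apply/seteqP; split=> [x ax|x [[x0 x1] x2] i]; first by do !split; exact: ax.
  by case: (ord3P i) => ->.
by apply: openI => //; exact: openI.
Qed.

Lemma open_triangle_sub a : nondegenerate a -> open_triangle a `<=` triangle a.
Proof. by move=> nda x ax; apply/triangleP => // i; exact/ltW. Qed.

Lemma open_triangle_nonempty a : nondegenerate a -> open_triangle a !=set0.
Proof.
(* The centroid, all of whose barycentric coordinates are 1/3. *)
move=> nda; exists (\sum_i 3^-1 *: a i) => i.
have [c [g bE]] := bary_affine a i.
rewrite bE affine_sum; last by rewrite big_ord3; field.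
under eq_bigr do rewrite -bE bary_vertex//.
rewrite (bigD1 i)//= eqxx mulr1 big1 ?addr0 ?invr_gt0//.
by move=> j ji; rewrite eq_sym (negbTE ji) mulr0.
Qed.

Lemma closed_triangle a : nondegenerate a -> closed (triangle a).
Proof.
move=> nda.
have -> : triangle a = \bigcap_(i in [set: 'I_3]) (bary a i @^-1` [set r | 0 <= r]).
  apply/seteqP; split=> x; first by move=> /(triangleP _ nda) ax i _; exact: ax.
  by move=> ax; apply/triangleP => // i; exact: ax.
apply: closed_bigI => i _.
by apply: closed_comp => [x _|]; [exact: continuous_bary|exact: closed_ge].
Qed.

Lemma triangle_vertex a i : triangle a (a i).
Proof.
exists (fun j => (j == i)%:R); split=> [j||]; first by case: eqP.
  by rewrite (bigD1 i)//= eqxx big1 ?addr0// => j /negbTE ->.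
by rewrite (bigD1 i)//= eqxx scale1r big1 ?addr0// => j /negbTE ->; rewrite scale0r.
Qed.

Lemma affine_on_bary a u : nondegenerate a -> affine_on (triangle a) u ->
  forall x, triangle a x -> u x = \sum_i bary a i x * u (a i).
Proof.
move=> nda [c [g uE]] x ax; rewrite uE// (affine_bary c g x nda).
by apply: eq_bigr => i _; rewrite uE//; exact: triangle_vertex.
Qed.

Lemma affine_seg_pt (c : R) g p q s :
  c + dot g (seg_pt p q s) = (1 - s) * (c + dot g p) + s * (c + dot g q).
Proof. by rewrite /dot /seg_pt /= /GRing.scale /=; ring. Qed.

Lemma segment_symm p q : segment p q = segment q p.
Proof.
suff sub p' q' : segment p' q' `<=` segment q' p' by apply/seteqP; split; exact: sub.
move=> _ [s /= s01 <-]; exists (1 - s) => /=.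
  by move: s01; rewrite !in_itv /=; lra.
by rewrite /seg_pt [LHS]surjective_pairing [RHS]surjective_pairing;
  congr pair => /=; rewrite /GRing.scale /=; ring.
Qed.

Lemma segmentl p q : segment p q p.
Proof. by exists 0 => /=; rewrite ?in_itv/= ?lexx ?ler01// /seg_pt scale0r addr0. Qed.

Lemma segmentr p q : segment p q q.
Proof. by rewrite segment_symm; exact: segmentl. Qed.

(* An endpoint of a segment is an extreme point of it. *)
Lemma segment_endpoint p q p' q' : segment p q = segment p' q' ->
  p = p' \/ p = q'.
Proof.
move=> E; have [s] : segment p' q' p by rewrite -E; exact: segmentl.
have [t] : segment p q p' by rewrite E; exact: segmentl.
have [r] : segment p q q' by rewrite E; exact: segmentr.
rewrite /= !in_itv /= /seg_pt => /andP[r0 _] qE /andP[t0 _] pE /andP[s0 s1] sE.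
have [pq|pq] := eqVneq p q; first by left; rewrite -pE pq subrr scaler0 addr0.
(* Expressing [p] by [p'], [q'] and these by [p], [q] gives this relation. Both summands of the
   coefficient are nonnegative, so [t = 0] unless [s = 1]. *)
have /eqP : ((1 - s) * t + s * r) *: (q - p) = 0.
  apply: (@addrI _ p); rewrite addr0 -[RHS]sE -pE -qE.
  rewrite [LHS]surjective_pairing [RHS]surjective_pairing.
  by congr pair => /=; rewrite /GRing.scale /=; ring.
rewrite scaler_eq0 subr_eq0 (eq_sym q) (negbTE pq) orbF => /eqP str0.
have [s10|s10] := eqVneq s 1.
  by right; rewrite -sE s10 scale1r addrC subrK.
left; rewrite -pE; suff -> : t = 0 by rewrite scale0r addr0.
have /eqP : (1 - s) * t = 0.
  have := mulr_ge0 s0 r0; have : 0 <= (1 - s) * t by rewrite mulr_ge0 ?subr_ge0.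
  by lra.
by rewrite mulf_eq0 subr_eq0 eq_sym (negbTE s10) => /eqP.
Qed.

(** [u] is prescribed on the triangle only; near an interior point its difference quotients are
    those of the affine function, hence constant. *)
Lemma grad_affine u a c g x : nondegenerate a ->
  (forall x, triangle a x -> u x = c + dot g x) -> open_triangle a x ->
  grad u x = g.
Proof.
move=> nda uE ax.
have D v : 'D_v u x = dot g v.
  rewrite (@near_eq_derive _ _ _ u (fun x => c + dot g x)); last first.
    near=> y; apply: uE; apply: open_triangle_sub => //.
    near: y; apply: open_nbhs_nbhs; split; [exact: open_open_triangle|exact: ax].
  apply/cvg_lim => //.
  apply: cvg_near_cst.
  near=> h.
  have h0 : h != 0 by near: h; exact: nbhs_dnbhs_neq.
  rewrite /dot /= /GRing.scale /=; field.
  exact: h0.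
by rewrite /grad !D /dot /= !mulr1 !mulr0 addr0 add0r -surjective_pairing.
Unshelve. all: by end_near. Qed.

(** * Side lengths, angles and the mesh constants *)

Lemma enorm_ge0 x : 0 <= enorm x.
Proof. exact: sqrtr_ge0. Qed.

Lemma sqr_enorm x : enorm x ^+ 2 = dot x x.
Proof. by rewrite sqr_sqrtr// /dot -!expr2 addr_ge0 ?sqr_ge0. Qed.

(** Serves twice: it bounds the cosine quotient by 1 and identifies the sine with an area over a
    product of sides. *)
Lemma lagrange x y : dot x y ^+ 2 + det2 x y ^+ 2 = (enorm x * enorm y) ^+ 2.
Proof. by rewrite exprMn !sqr_enorm /dot /det2; ring. Qed.

(** Numbered by the opposite vertex, the convention of the law of sines. *)
Definition side a i : R := enorm (a (i + 1) - a (i + 2)).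

Lemma side_anglel a i : enorm (a (i + 1) - a i) = side a (i + 2).
Proof.
rewrite /side /enorm /dot; case: (ord3P i) => ->; rewrite !ord3_add /=;
  congr Num.sqrt; ring.
Qed.

Lemma side_angler a i : enorm (a (i + 2) - a i) = side a (i + 1).
Proof.
rewrite /side /enorm /dot; case: (ord3P i) => ->; rewrite !ord3_add /=;
  congr Num.sqrt; ring.
Qed.

Lemma det2_angle a i : det2 (a (i + 1) - a i) (a (i + 2) - a i) = area2 a.
Proof.
by rewrite /area2 /det2; case: (ord3P i) => ->; rewrite !ord3_add /=; ring.
Qed.

Lemma side_gt0 a i : nondegenerate a -> 0 < side a i.
Proof.
move=> /nondegenerateP D; rewrite lt0r enorm_ge0 andbT.
(* Side [i] is one of the two sides meeting at vertex [i + 1], so a zero length would make the area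
   vanish. *)
have := lagrange (a (i + 1 + 1) - a (i + 1)) (a (i + 1 + 2) - a (i + 1)).
rewrite side_anglel det2_angle.
have -> : i + 1 + 2 = i by case: (ord3P i) => ->; rewrite !ord3_add.
move=> L; apply/eqP => s0; move/eqP: L.
rewrite s0 mul0r expr0n /= paddr_eq0 ?sqr_ge0// !sqrf_eq0.
by rewrite (negbTE D) andbF.
Qed.

Lemma cos_angle_itv a i : nondegenerate a ->
  -1 <= dot (a (i + 1) - a i) (a (i + 2) - a i) /
    (enorm (a (i + 1) - a i) * enorm (a (i + 2) - a i)) <= 1.
Proof.
set b := a (i + 1) - a i; set c := a (i + 2) - a i => nda.
rewrite -ler_norml normrM normfV.
have bc0 : 0 < enorm b * enorm c.
  by rewrite side_anglel side_angler mulr_gt0// side_gt0.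
rewrite (gtr0_norm bc0) ler_pdivrMr// mul1r -ler_sqr ?nnegrE ?mulr_ge0 ?enorm_ge0 //.
by rewrite real_normK ?num_real// -lagrange lerDl sqr_ge0.
Qed.

Lemma dot_angle a i : nondegenerate a ->
  dot (a (i + 1) - a i) (a (i + 2) - a i) =
    cos (angle a i) * (side a (i + 1) * side a (i + 2)).
Proof.
move=> nda; rewrite /angle acosK; last by rewrite in_itv/= cos_angle_itv.
rewrite side_anglel side_angler [_ * side a (i + 1)]mulrC divfK//.
by rewrite gt_eqF// mulr_gt0// side_gt0.
Qed.

(** Law of sines: the factor in front of [side a i] does not depend on [i]. It comes from
    [sin (acos t)] being the square root of [1 - t ^+ 2], rewritten by [lagrange]. *)
Lemma sin_angle a i : nondegenerate a ->
  sin (angle a i) = `|area2 a| / (side a 0 * side a 1 * side a 2) * side a i.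
Proof.
move=> nda; rewrite /angle sin_acos ?cos_angle_itv//.
set b := a (i + 1) - a i; set c := a (i + 2) - a i.
have bc0 : enorm b * enorm c != 0.
  by rewrite gt_eqF// side_anglel side_angler mulr_gt0// side_gt0.
have -> : 1 - (dot b c / (enorm b * enorm c)) ^+ 2 =
    (area2 a / (enorm b * enorm c)) ^+ 2.
  rewrite -(det2_angle a i) -/b -/c !exprMn exprVn.
  have L := lagrange b c; apply/eqP.
  rewrite subr_eq -mulrDl addrC L divff// expf_neq0//.
rewrite sqrtr_sqr normrM normfV (ger0_norm (mulr_ge0 (enorm_ge0 _) (enorm_ge0 _))).
rewrite side_anglel side_angler.
have := side_gt0 0 nda; have := side_gt0 1 nda; have := side_gt0 2 nda.
by case: (ord3P i) => ->; rewrite !ord3_add => *; field; rewrite !gt_eqF.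
Qed.

(** By the law of sines the ratios minimised in [gammaT] are ratios of side lengths. *)
Lemma gammaT_le_side a i j : nondegenerate a ->
  gammaT a * side a j <= side a i.
Proof.
move=> nda; rewrite -ler_pdivlMr ?side_gt0//.
rewrite /gammaT; apply: le_trans (bigmin_le _ i _) _.
apply: le_trans (bigmin_le _ j _) _.
rewrite !sin_angle// -mulf_div divff ?mul1r// mulf_neq0//.
  by rewrite normr_eq0.
by rewrite invr_eq0 !mulf_neq0// gt_eqF ?side_gt0.
Qed.

Lemma sin_angle_gt0 a i : nondegenerate a -> 0 < sin (angle a i).
Proof.
move=> nda; rewrite sin_angle// mulr_gt0 ?side_gt0// divr_gt0 ?normr_gt0//.
by rewrite !mulr_gt0 ?side_gt0.
Qed.

Lemma gammaT_gt0 a : nondegenerate a -> 0 < gammaT a.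
Proof.
move=> nda; rewrite /gammaT; do 2![apply: lt_bigmin => // ? _].
by rewrite divr_gt0 ?sin_angle_gt0.
Qed.

Lemma gammaT_le1 a : gammaT a <= 1.
Proof. exact: bigmin_le_id. Qed.

Lemma cT_le a i : cT a <= cos (angle a i).
Proof. exact: bigmin_le. Qed.

Lemma max_jump_ge a (u : R * R -> R) i j : `|u (a i) - u (a j)| <= max_jump a u.
Proof.
rewrite /max_jump; apply: le_trans (le_bigmax _ _ i).
exact: (le_bigmax _ (fun j => `|u (a i) - u (a j)|)).
Qed.

(** * Positivity of the flux difference on one triangle *)

(** Inverting the Gram matrix of [b] and [c] expresses [dot g h] by the edge increments of [g] and
    [h]. With [b] and [c] the edges issuing from a vertex, the weights [dot c (c - b)] and
    [dot b (b - c)] carry the cosines at the other two vertices. *)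
Lemma dot_const_edges g h b c (s : R) : dot h b = s -> dot h c = s ->
  det2 b c ^+ 2 * dot g h =
    s * (dot g b * dot c (c - b) + dot g c * dot b (b - c)).
Proof.
move=> hb hc.
have -> : det2 b c ^+ 2 * dot g h =
    dot g b * (dot h b * dot c c - dot h c * dot b c) +
    dot g c * (dot h c * dot b b - dot h b * dot b c).
  by rewrite /dot /det2; ring.
by rewrite hb hc /dot /=; ring.
Qed.

(* The factor 7 / 6 of the mesh condition is slack, and so is one of the two
   factors [1 / gamma]. *)
Lemma mesh_condition_margin (ka L J gamma c x y E W1 W2 d1 d2 A B k delta : R) :
  0 < ka -> 0 < L -> 0 <= J -> 0 < gamma -> gamma <= 1 ->
  0 < x -> 0 < y -> 0 < E -> gamma * x <= y -> gamma * y <= x ->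
  gamma^-1 * (1 + gamma^-1) * J < 6 * ka * c / (7 * L) ->
  c * (E * x) <= d1 <= E * x -> c * (E * y) <= d2 <= E * y ->
  0 <= W1 -> 0 <= W2 -> 0 < W1 + W2 ->
  ka <= k -> `|delta| <= L * (W1 + W2) ->
  `|A| <= J -> `|B| <= J ->
  0 < k * (W1 * d1 + W2 * d2) + delta * (A * d1 + B * d2).
Proof.
move=> ka0 L0 J0 g0 g1 x0 y0 E0 gxy gyx mesh.
move=> /andP[d1l d1u] /andP[d2l d2u] W10 W20 W0 kak dL AJ BJ.
pose r := 1 + gamma^-1.
have gi1 : 1 <= gamma^-1 by rewrite invf_ge1.
have r0 : 0 < r by rewrite /r; lra.
have rJ : L * (r * J) < ka * c.
  have : gamma^-1 * r * J * (7 * L) < 6 * ka * c by rewrite -ltr_pdivlMr ?mulr_gt0.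
  have : r * J <= gamma^-1 * r * J.
    by rewrite -mulrA ler_peMl// mulr_ge0 // ltW.
  have : 0 <= r * J by rewrite mulr_ge0 // ltW.
  nra.
have c0 : 0 < c.
  have : 0 <= L * (r * J) by rewrite !mulr_ge0 // ltW.
  by move=> /le_lt_trans /(_ rJ); rewrite pmulr_rgt0.
(* [m] is the smaller of [x] and [y]; the larger one is at most [gamma^-1 * m]. *)
have [m [m0 mx my xym]] : exists m, [/\ 0 < m, m <= x, m <= y & x + y <= r * m].
  have [xy|/ltW yx] := leP x y.
    exists x; split => //.
    have : y <= gamma^-1 * x by rewrite mulrC ler_pdivlMr // mulrC.
    by rewrite /r; lra.
  exists y; split => //.
  have : x <= gamma^-1 * y by rewrite mulrC ler_pdivlMr // mulrC.
  by rewrite /r; lra.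
have d10 : 0 <= d1 by apply: le_trans d1l; rewrite !mulr_ge0 // ltW.
have d20 : 0 <= d2 by apply: le_trans d2l; rewrite !mulr_ge0 // ltW.
(* Both terms are compared with the same quantity [E * m * (W1 + W2)]: the first is at least
   [ka * c] times it, the second at most [L * (r * J)] times it in absolute value, and [rJ]
   separates the two factors. *)
have lower : ka * c * (E * m * (W1 + W2)) <= k * (W1 * d1 + W2 * d2).
  have d1m : c * (E * m) <= d1.
    by apply: le_trans d1l; rewrite !ler_wpM2l // ltW.
  have d2m : c * (E * m) <= d2.
    by apply: le_trans d2l; rewrite !ler_wpM2l // ltW.
  have S : c * (E * m) * (W1 + W2) <= W1 * d1 + W2 * d2.
    have := ler_wpM2l W10 d1m; have := ler_wpM2l W20 d2m; lra.
  have S0 : 0 <= c * (E * m) * (W1 + W2) by rewrite !mulr_ge0 // ltW.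
  apply: le_trans (ler_wpM2r (le_trans S0 S) kak).
  by have := ler_wpM2l (ltW ka0) S; lra.
have upper : `|delta * (A * d1 + B * d2)| <= L * (r * J) * (E * m * (W1 + W2)).
  have S : `|A * d1 + B * d2| <= J * (E * (r * m)).
    apply: le_trans (ler_normD _ _) _;
    rewrite !normrM (ger0_norm d10) (ger0_norm d20).
    apply: (@le_trans _ _ (J * (E * x) + J * (E * y))).
      by rewrite lerD // ler_pM.
    by rewrite -mulrDr ler_wpM2l // -mulrDr ler_wpM2l // ltW.
  rewrite normrM; apply: le_trans (ler_pM _ _ dL S) _ => //.
  rewrite le_eqVlt; apply/orP; left; apply/eqP; ring.
have EmW : 0 < E * m * (W1 + W2) by rewrite !mulr_gt0.
have := ltr_pM2r EmW (L * (r * J)) (ka * c); rewrite rJ => strict.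
move: upper; rewrite ler_norml => /andP[+ _]; move: lower strict.
lra.
Qed.

(** Two of three booleans always agree; the third one singles out the odd vertex. *)
Lemma mixed_signs (b : 'I_3 -> bool) : (exists i j, b i != b j) ->
  exists i, b (i + 1) = ~~ b i /\ b (i + 2) = ~~ b i.
Proof.
move=> bij.
suff : [\/ b 1 = ~~ b 0 /\ b 2 = ~~ b 0, b 2 = ~~ b 1 /\ b 0 = ~~ b 1
         | b 0 = ~~ b 2 /\ b 1 = ~~ b 2].
  by case=> ?; [exists 0|exists 1|exists 2]; rewrite !ord3_add.
case: bij => i [j]; case: (ord3P i) => ->; case: (ord3P j) => ->; rewrite ?eqxx//;
  case: (b 0); case: (b 1); case: (b 2) => //= _;
  by [apply: Or31|apply: Or32|apply: Or33].
Qed.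

(** Applied pointwise with [k] the coefficient at [u1] and [delta] its difference between [u1] and
    [u2]. The bound on [delta] ranges over all [B] dominating the nodal values of [w], since [w] at
    a point is a convex combination of them. *)
Lemma flux_difference_gt0 a (u : R * R -> R) (W : 'I_3 -> R) (ka L k delta : R)
    (gw gu gv : R * R) :
  nondegenerate a ->
  0 < ka -> 0 < L ->
  (gammaT a)^-1 * (1 + (gammaT a)^-1) * max_jump a u < 6 * ka * cT a / (7 * L) ->
  (forall i j, dot gw (a i - a j) = W i - W j) ->
  (forall i j, dot gu (a i - a j) = u (a i) - u (a j)) ->
  (forall i j, dot gv (a i - a j) = (0 < W i)%R%:R - (0 < W j)%R%:R) ->
  (exists i j, (0 < W i) != (0 < W j)) ->
  ka <= k ->
  (forall B : R, (forall i, `|W i| <= B) -> `|delta| <= L * B) ->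
  0 < k * dot gw gv + delta * dot gu gv.
Proof.
move=> nda ka0 L0 mesh gwE guE gvE /mixed_signs[i [Wq Wr]] kak dB.
set b := a (i + 1) - a i; set c := a (i + 2) - a i.
(* [s] is 1 or -1, the increment of the test function from the odd vertex to either of the
   others. *)
pose s : R := (~~ (0 < W i)%R)%:R - (0 < W i)%R%:R.
have Db : dot gv b = s by rewrite gvE Wq.
have Dc : dot gv c = s by rewrite gvE Wr.
(* Scaling by the square of [area2 a] brings both products into the form of [dot_const_edges]. *)
have D0 : 0 < area2 a ^+ 2 by rewrite lt0r sqrf_eq0 sqr_ge0 andbT.
rewrite -(pmulr_rgt0 _ D0) mulrDr mulrCA [X in _ + X]mulrCA.
rewrite -(det2_angle a i) -/b -/c !(dot_const_edges _ Db Dc).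
rewrite !gwE !guE.
have d1E : dot c (c - b) = cos (angle a (i + 2)) * (side a i * side a (i + 1)).
  have := dot_angle (i + 2) nda.
  have [_ _ -> ->] := ord3_next i => <-.
  by rewrite /b /c /dot /=; ring.
have d2E : dot b (b - c) = cos (angle a (i + 1)) * (side a i * side a (i + 2)).
  have := dot_angle (i + 1) nda.
  have [-> -> _ _] := ord3_next i; rewrite [side a (i + 2) * _]mulrC => <-.
  by rewrite /b /c /dot /=; ring.
have cos_itv j : cT a <= cos (angle a j) <= 1 by rewrite cT_le cos_le1.
have side_itv j l : cT a * (side a i * side a j) <=
    cos (angle a l) * (side a i * side a j) <= side a i * side a j.
  have ss : 0 <= side a i * side a j by rewrite mulr_ge0 ?enorm_ge0.
  have /andP[c1 c2] := cos_itv l.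
  by rewrite ler_wpM2r//= -[leRHS]mul1r ler_wpM2r.
have s1 : `|s| = 1.
  by rewrite /s; case: (0 < W i); rewrite /= ?subr0 ?sub0r ?normrN normr1.
(* As [W] changes sign between [i] and the other vertices, multiplying by [s] yields the absolute
   values of the increments, and these dominate the nodal values. *)
set W1 := s * (W (i + 1) - W i); set W2 := s * (W (i + 2) - W i).
have [W10 W20 W0 WB] : [/\ 0 <= W1, 0 <= W2, 0 < W1 + W2 &
    forall j, `|W j| <= W1 + W2].
  have cover j : [\/ j = i, j = i + 1 | j = i + 2].
    by case: (ord3P j) => ->; case: (ord3P i) => ->; rewrite !ord3_add;
      by [apply: Or31|apply: Or32|apply: Or33].
  move: Wq Wr; rewrite /W1 /W2 /s.
  case: (ltP 0 (W i)) => /= Wi; [move=> /negbT + /negbT|];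
    rewrite ?(=^~ leNgt) => Wq Wr; split; try lra;
    by move=> j; case: (cover j) => ->; rewrite ler_norml; apply/andP; split; lra.
(* Here [x] and [y] are the sides meeting at vertex [i], [E] is the side opposite to it, and [J] is
   [max_jump a u]. *)
have := mesh_condition_margin (k := k) (delta := delta) (W1 := W1) (W2 := W2)
  (A := s * (u (a (i + 1)) - u (a i))) (B := s * (u (a (i + 2)) - u (a i)))
  ka0 L0 (le_trans (normr_ge0 _) (max_jump_ge a u 0 0)) (gammaT_gt0 nda)
  (gammaT_le1 a) (side_gt0 (i + 1) nda) (side_gt0 (i + 2) nda) (side_gt0 i nda)
  (gammaT_le_side _ _ nda) (gammaT_le_side _ _ nda) mesh
  (side_itv _ (i + 2)) (side_itv _ (i + 1)) W10 W20 W0 kak (dB _ WB).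
rewrite -d1E -d2E !normrM s1 !mul1r => /(_ (max_jump_ge _ _ _ _)).
move=> /(_ (max_jump_ge _ _ _ _)) /lt_le_trans; apply.
rewrite le_eqVlt; apply/orP; left; apply/eqP; rewrite /W1 /W2; ring.
Qed.

End Geometry.

(** * Two-valued continuous functions on connected sets *)

(** If both values occurred, the image, being an interval, would contain 1/2. *)
Lemma connected_01_constant (R : realType) (X : topologicalType) (A : set X)
    (v : X -> R) : connected A -> {within A, continuous v} ->
  (forall x, A x -> v x = 0 \/ v x = 1) ->
  (forall x, A x -> v x = 0) \/ (forall x, A x -> v x = 1).
Proof.
move=> cA cv v01.
have [[x Ax vx]|nx] := pselect (exists2 x, A x & v x = 0); last first.
  by right=> x Ax; case: (v01 _ Ax) => // vx; exfalso; apply: nx; exists x.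
left=> y Ay; case: (v01 _ Ay) => // vy; exfalso.
have /connected_intervalP vI := connected_continuous_connected cA cv.
have [z Az vz] : (v @` A) (2^-1 : R).
  apply: (vI 0 1); [by exists x|by exists y|].
  by rewrite invr_ge0 ler0n /= invf_le1 ?ler1n.
by case: (v01 _ Az); rewrite vz; lra.
Qed.

(** * Continuous piecewise affine interpolation of nodal values *)

Section NodalInterpolation.
Context {R : realType} {n : nat}.
Variables (T : 'I_n -> 'I_3 -> R * R) (A : set (R * R)).
Hypothesis cT : conforming_triangulation T A.
Variable y : R * R -> R.

Definition bary_interp (a : 'I_3 -> R * R) x : R :=
  \sum_i bary a i x * y (a i).

(** The choice among several triangles containing [x] is immaterial by [bary_interp_compat]; 0 is a
    default off the mesh. *)
Definition nodal_interp x : R :=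
  if [pick k | `[< triangle (T k) x >]] is Some k then bary_interp (T k) x else 0.

Lemma bary_interp_affine a : exists c g, forall x, bary_interp a x = c + dot g x.
Proof.
have /choice[c /choice[g bE]] i := bary_affine a i.
exists (\sum_i c i * y (a i)), (\sum_i (g i).1 * y (a i), \sum_i (g i).2 * y (a i)).
by move=> x; rewrite /bary_interp /dot /= !big_ord3 !bE /dot; ring.
Qed.

Lemma bary_interp_vertex a i : nondegenerate a -> bary_interp a (a i) = y (a i).
Proof.
move=> nda; rewrite /bary_interp (bigD1 i)//= bary_vertex// eqxx mul1r.
by rewrite big1 ?addr0// => j ji; rewrite bary_vertex// (negbTE ji) mul0r.
Qed.

(** Two triangles share at most a vertex or an edge, and an affine function on an edge is determined
    by its endpoint values. *)
Lemma bary_interp_compat k l x : triangle (T k) x -> triangle (T l) x ->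
  bary_interp (T k) x = bary_interp (T l) x.
Proof.
have [nd _ meet] := cT; move=> Tk Tl.
have [->//|kl] := eqVneq k l.
have Ix : (triangle (T k) `&` triangle (T l)) x by [].
case: (meet k l kl) => [I0|[i [j [ij I1]]]|[i [j [ij I1]]]].
- by rewrite I0 in Ix.
- by rewrite I1 in Ix; rewrite Ix [in RHS]ij !bary_interp_vertex// ij.
have [s _ <-] : edge T k i x by rewrite -I1.
have [ck [gk kE]] := bary_interp_affine (T k).
have [cl [gl lE]] := bary_interp_affine (T l).
(* The common edge is given as an equality of sets, possibly with opposite orientations;
   [segment_endpoint] matches the endpoints up to order. *)
have vertexE m : T k m = T l j \/ T k m = T l (j + 1) ->
    bary_interp (T k) (T k m) = bary_interp (T l) (T k m).
  by rewrite bary_interp_vertex// => -[] ->; rewrite bary_interp_vertex.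
rewrite kE lE !affine_seg_pt -!kE -!lE !vertexE//.
- by apply: segment_endpoint; rewrite segment_symm; exact: ij.
- exact: segment_endpoint ij.
Qed.

Lemma nodal_interpE k x : triangle (T k) x -> nodal_interp x = bary_interp (T k) x.
Proof.
rewrite /nodal_interp; case: pickP => [l /asboolP Tl Tk|/(_ k) /asboolP//].
exact: bary_interp_compat.
Qed.

Lemma nodal_interp_vertex k i : nodal_interp (T k i) = y (T k i).
Proof.
have [nd _ _] := cT.
by rewrite (nodal_interpE (triangle_vertex _ _)) bary_interp_vertex.
Qed.

Lemma nodal_interp_affine k : affine_on (triangle (T k)) nodal_interp.
Proof.
have [c [g bE]] := bary_interp_affine (T k); exists c, g => x Tx.
by rewrite (nodal_interpE Tx) bE.
Qed.

(** Near [x] only the triangles containing [x] matter, because the others are closed and finite in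
    number; on each of these the function is affine. *)
Lemma nodal_interp_continuous : {within closure A, continuous nodal_interp}.
Proof.
have [nd AT _] := cT.
apply/subspace_continuousP => x; rewrite AT => -[k0 _ Tk0].
apply/cvgrPdist_lt => e e0; rewrite near_withinE.
have : \forall z \near x, forall k, triangle (T k) z ->
    `|nodal_interp x - nodal_interp z| < e.
  apply: (@filter_forall _ _ (fun k z => triangle (T k) z ->
    `|nodal_interp x - nodal_interp z| < e) (nbhs x) (nbhs_filter x)) => k.
  have [Tx|nTx] := pselect (triangle (T k) x).
    have [c [g bE]] := nodal_interp_affine k.
    have /cvgrPdist_lt/(_ e e0) := @continuous_affine _ c g x.
    by apply: filterS => z + Tz; rewrite !bE.
  have : nbhs x (~` triangle (T k)).
    by apply: open_nbhs_nbhs; split => //; exact/closed_openC/closed_triangle.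
  by apply: filterS => z nTz /nTz.
by apply: filterS => z Hz [k _ Tz]; exact: Hz Tz.
Qed.

End NodalInterpolation.

(** * Almost-everywhere arguments, integrability and complete measures *)

(** A negative value would persist on a nonempty open set, which contains a rational. *)
Lemma continuous_ge0_rat (R : realType) (f : R -> R) : continuous f ->
  (forall q : rat, 0 <= f (ratr q)) -> forall s, 0 <= f s.
Proof.
move=> cf fq s; rewrite leNgt; apply/negP => fs.
have oN : open (f @^-1` [set r | r < 0]).
  by apply: open_comp => [x _|]; [exact: cf|exact: open_lt].
have [r [/= + [q _ qE]]] := @dense_rat R _ (ex_intro _ s fs) oN.
by rewrite -qE ltNge fq.
Qed.

Section CompleteMeasure.
Context d (X : measurableType d) (R : realType) (mu : {measure set X -> \bar R}).

Lemma ae_forall_countable (I : countType) (P : I -> X -> Prop) :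
  (forall i, {ae mu, forall x, P i x}) -> {ae mu, forall x, forall i, P i x}.
Proof.
move=> aP; pose Q n x := if unpickle n is Some i then P i x else True.
have : {ae mu, forall x, forall n, Q n x}.
  apply: ae_foralln => n; rewrite /Q; case: unpickle => [i|]; first exact: aP.
  exact: aeW.
by apply: filterS => x Qx i; have := Qx (pickle i); rewrite /Q pickleK.
Qed.

(** A zero integral would force [f] to vanish almost everywhere on [D], against its positivity on
    [A]. *)
Lemma Rintegral_gt0 (D A : set X) (f : X -> R) : measurable D ->
  mu.-integrable D (EFin \o f) ->
  {ae mu, forall x, D x -> 0 <= f x} ->
  A `<=` D -> measurable A -> mu A != 0%E ->
  {ae mu, forall x, A x -> 0 < f x} ->
  0 < \int[mu]_(x in D) f x.
Proof.
move=> mD If f0 AD mA A0 fA.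
have mf := measurable_int mu If.
have E : (\int[mu]_(x in D) (f x)%:E = \int[mu]_(x in D) `|(f x)%:E|)%E.
  apply: ae_eq_integral => //.
    exact: (measurableT_comp (@abse_measurable R setT) mf).
  rewrite /ae_eq.
  by apply: filterS f0 => x + Dx => /(_ Dx) fx; rewrite gee0_abs ?lee_fin.
rewrite /Rintegral E lt0r fine_ge0 ?integral_ge0// andbT; apply/eqP => I0.
have fin : (\int[mu]_(x in D) `|(f x)%:E|)%E \is a fin_num.
  by rewrite ge0_fin_numE ?integral_ge0//; case/integrableP: If.
have /(ae_eq_integral_abs mu mD mf) fae : (\int[mu]_(x in D) `|(f x)%:E|)%E = 0%E.
  by rewrite -(fineK fin) I0.
case/eqP: A0; apply: measure_negligible => //.
have : {ae mu, forall x, ~ A x}.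
  apply: filterS2 fae fA => x + + Ax => /(_ (AD _ Ax)) [->] /(_ Ax).
  by rewrite ltxx.
by apply: negligibleS => x Ax; exact.
Qed.

Lemma measurable_fun_mulr_cst (D : set X) (f : X -> R) (c : R) :
  measurable_fun D f -> measurable_fun D (fun x => f x * c).
Proof. by move=> mf; exact: measurable_funM. Qed.

Lemma ae_bounded_integrable (D : set X) (f : X -> R) (B : R) :
  measurable D -> (mu D < +oo)%E -> measurable_fun D f -> 0 <= B ->
  {ae mu, forall x, D x -> `|f x| <= B} -> mu.-integrable D (EFin \o f).
Proof.
move=> mD Doo mf B0 fB; have mEf : measurable_fun D (EFin \o f).
  exact/measurable_EFinP.
apply/integrableP; split => //.
apply: (@le_lt_trans _ _ (B%:E * mu D)%E); last by rewrite lte_mul_pinfty ?lee_fin.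
apply: integral_le_bound => //; rewrite ?lee_fin//.
Qed.

Lemma Lfun2_bounded_integrable (D : set X) (f v : X -> R) :
  measurable D -> (mu D < +oo)%E -> f \_ D \in Lfun mu 2%:E ->
  measurable_fun D v -> (forall x, D x -> `|v x| <= 1) ->
  mu.-integrable D (EFin \o (fun x => f x * v x)).
Proof.
move=> mD Doo fL2 mv v1.
have mf : measurable_fun D f.
  apply/(measurable_restrictT _ mD).
  by move: fL2; rewrite inE => /andP[/[!inE]/=].
have If2 : mu.-integrable D (fun x => (f x ^+ 2)%:E).
  have := Lfun2_integrable_sqr fL2.
  move=> /(integrableS measurableT mD (@subsetT _ _)).
  by apply: eq_integrable => // x xD /=; rewrite patchE xD.
have I1 : mu.-integrable D (EFin \o cst 1).
  by apply: measurable_bounded_integrable => //; exact: bounded_cst.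
(* The dominating function [1 + f ^+ 2] comes from expanding the square of [|f| - 1]; it is
   integrable because [D] has finite measure. *)
apply: (@le_integrable _ _ _ _ _ mD _ (fun x => (1 + f x ^+ 2)%:E)).
- by apply/measurable_EFinP; exact: measurable_funM.
- move=> x Dx; rewrite lee_fin normrM [leRHS]ger0_norm ?addr_ge0 ?sqr_ge0//.
  apply: le_trans (ler_piMr (normr_ge0 _) (v1 x Dx)) _.
  rewrite -[f x ^+ 2]real_normK ?num_real//.
  by have := sqr_ge0 (`|f x| - 1); have := normr_ge0 (f x); lra.
- exact: (integrableD mD I1 If2).
Qed.

Hypothesis cmu : measure_is_complete mu.

(** What the pieces miss is negligible, hence measurable by completeness. *)
Lemma measurable_pieces (I : Type) (D : set X) (F : I -> set X) :
  countable [set: I] ->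
  (forall i, measurable (F i)) -> (forall i, F i `<=` D) ->
  {ae mu, forall x, D x -> exists i, F i x} -> measurable D.
Proof.
move=> cI mF FD DF.
have -> : D = \bigcup_i F i `|` (D `\` \bigcup_i F i).
  by rewrite setDUK// => x [i _]; exact: FD.
apply: measurableU; first exact: countable_bigcupT_measurable.
apply: cmu; apply: negligibleS DF => x [Dx nF] /=.
by move=> /(_ Dx) [i Fx]; apply: nF; exists i.
Qed.

Lemma measurable_fun_pieces d' (Y : measurableType d') (I : Type)
    (D : set X) (F : I -> set X) (f : X -> Y) :
  countable [set: I] ->
  (forall i, measurable (F i)) -> (forall i, F i `<=` D) ->
  {ae mu, forall x, D x -> exists i, F i x} ->
  (forall i, measurable_fun (F i) f) -> measurable_fun D f.
Proof.
move=> cI mF FD DF mf _ Z mZ.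
have -> : D `&` f @^-1` Z = \bigcup_i (F i `&` f @^-1` Z) `|`
    ((D `&` f @^-1` Z) `\` \bigcup_i F i).
  apply/seteqP; split=> [x [Dx fx]|x [[i _ [Fx fx]]|[[]]]//].
    have [[i _ Fx]|nF] := pselect ((\bigcup_i F i) x); last by right.
    by left; exists i.
  by split => //; exact: FD Fx.
apply: measurableU.
  by apply: countable_bigcupT_measurable => // i; exact: mf.
apply: cmu; apply: negligibleS DF => x [[Dx _] nF] /=.
by move=> /(_ Dx) [i Fx]; apply: nF; exists i.
Qed.

(** [u] is approximated by the functions [q n], whose values are multiples of [1 / n.+1]; continuity
    of [kappa x] carries measurability to the limit. *)
Lemma measurable_fun_caratheodory (D : set X) (kappa : X -> R -> R) (u : X -> R) :
  measurable D -> (forall s, measurable_fun D (kappa ^~ s)) ->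
  {ae mu, forall x, D x -> continuous (kappa x)} ->
  measurable_fun D u -> measurable_fun D (fun x => kappa x (u x)).
Proof.
move=> mD mk [N [mN N0 Nc]] mu_.
have mDN : measurable (D `\` N) by exact: measurableD.
apply: (@measurable_fun_pieces _ _ unit D (fun=> D `\` N)) => //.
- exists N; split => // x /= DN; apply: contrapT => Nx; apply: DN => Dx.
  by exists tt.
pose q n x : R := (Num.floor (u x * n.+1%:R))%:~R / n.+1%:R.
move=> _.
apply: (@measurable_fun_cvg _ _ _ _ (fun n x => kappa x (q n x))) => [n|x [Dx Nx]].
  apply: (@measurable_funS _ _ _ _ D) => //.
  move=> _ Z mZ.
  pose F (z : int) := (D `&` u @^-1` `[z%:~R / n.+1%:R, (z + 1)%:~R / n.+1%:R[) `&`
    (D `&` (kappa ^~ (z%:~R / n.+1%:R)) @^-1` Z).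
  (* Where the floor equals [z], the second argument of [kappa] is a constant; these level sets are
     countably many. *)
  have -> : D `&` (fun x => kappa x (q n x)) @^-1` Z = \bigcup_z F z.
    apply/seteqP; split=> [x [Dx kx]|x [z _ [[Dx /= uz] [_ kx]]]].
      exists (Num.floor (u x * n.+1%:R)) => //; split; split => //=.
      rewrite in_itv /= ler_pdivrMr ?ltr_pdivlMr ?ltr0n//.
      exact: floor_itv.
    split=> //=; rewrite /q (_ : Num.floor _ = z)//.
    apply: floor_def.
    by move: uz; rewrite in_itv /= ler_pdivrMr ?ltr_pdivlMr ?ltr0n.
  apply: countable_bigcupT_measurable => // z; apply: measurableI.
    by apply: mu_ => //; exact: measurable_itv.
  exact: mk.
have kc : continuous (kappa x) by apply: contrapT => nc; apply/Nx/Nc => /(_ Dx).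
apply: continuous_cvg; first exact: kc.
apply/cvgrPdist_le => e e0; near=> n.
have n0 : 0 < n.+1%:R :> R by rewrite ltr0n.
have /andP[l1 l2] := floor_itv (u x * n.+1%:R).
have en : n.+1%:R^-1 <= e.
  by by apply: ltW; near: n; exact: near_infty_natSinv_lt (PosNum e0).
apply: le_trans en.
have -> : u x - q n x = (u x * n.+1%:R - (Num.floor (u x * n.+1%:R))%:~R) / n.+1%:R.
  by rewrite mulrBl mulfK ?gt_eqF.
rewrite normrM normfV.
rewrite (gtr0_norm n0) ler_piMl ?invr_ge0 ?ler0n// ler_norml.
by move: l1 l2; rewrite intrD; lra.
Unshelve. all: by end_near. Qed.

End CompleteMeasure.

(** * Completed Lebesgue measure in the plane *)

Local Notation borelR2 R := (measurableTypeR R * measurableTypeR R)%type.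

Section Lebesgue2.
Context {R : realType}.
Implicit Types (x g : R * R) (c : R) (A : set (R * R)).

Lemma leb2_complete : measure_is_complete (@leb2 R : set (lebR2 R) -> \bar R).
Proof. exact: measure_is_complete_caratheodory. Qed.

#[global] Instance leb2_ae_filter : Filter (nbhs (almost_everywhere (@leb2 R))).
Proof. exact: (@ae_filter_ringOfSetsType _ _ _ (@leb2 R)). Qed.

Lemma measurable_lebR2 (A : set (borelR2 R)) :
  measurable A -> measurable (A : set (lebR2 R)).
Proof. exact: caratheodory_measurable_mu_ext. Qed.

Lemma leb2E (A : set (borelR2 R)) : measurable A ->
  leb2 A = (@lebesgue_measure R \x @lebesgue_measure R)%E A.
Proof. exact: measurable_mu_extE. Qed.

Lemma leb2_box (A B : set R) : measurable A -> measurable B ->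
  measurable (A `*` B : set (lebR2 R)) /\
  leb2 (A `*` B) = (lebesgue_measure A * lebesgue_measure B)%E.
Proof.
move=> mA mB; have mAB : measurable (A `*` B : set (borelR2 R)).
  exact: measurableX.
split; first exact: measurable_lebR2.
by rewrite leb2E// product_measure1E.
Qed.

Lemma measurable_affine_borel c g :
  measurable_fun [set: borelR2 R] (fun x : borelR2 R => c + dot g x).
Proof.
apply: measurable_funD => //; apply: measurable_funD; apply: measurable_funM => //.
Qed.

Lemma measurable_affine c g (A : set (lebR2 R)) :
  measurable_fun A (fun x : lebR2 R => c + dot g x).
Proof.
move=> mA Z mZ; apply: measurableI => //; apply: measurable_lebR2.
by rewrite -[X in measurable X]setTI; exact: measurable_affine_borel.
Qed.

(** A vertical line is a point times the real line; any other line meets each vertical section in a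
    single point, so its product measure integrates zeros. *)
Lemma negligible_line c g : g != 0 ->
  leb2.-negligible ([set x | c + dot g x = 0] : set (lebR2 R)).
Proof.
move=> g0; set A := [set x | _].
have mA : measurable (A : set (borelR2 R)).
  rewrite (_ : A = [set: borelR2 R] `&` (fun x => c + dot g x) @^-1` [set 0]).
    exact: measurable_affine_borel.
  by rewrite setTI.
apply/negligibleP; first exact: measurable_lebR2.
rewrite [LHS](leb2E mA).
have [g20|g20] := eqVneq g.2 0.
  have g10 : g.1 != 0.
    by apply: contraNneq g0 => g1; rewrite [g]surjective_pairing g1 g20.
  have -> : A = [set - c / g.1] `*` setT.
    apply/seteqP; split=> [x|x [/= xE _]]; rewrite /A /= /dot g20 mul0r addr0.
      move=> E; split => //=; apply: (mulfI g10).
      by rewrite [RHS]mulrC divfK//; apply/eqP; rewrite -addr_eq0 addrC E.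
    by rewrite xE; field.
  rewrite product_measure1E//; apply/eqP; rewrite mule_eq0; apply/orP; left.
  exact/eqP/lebesgue_measure_set1.
rewrite /product_measure1 /=.
apply: integral0_eq => x _ /=.
have -> : xsection A x = [set - (c + g.1 * x) / g.2].
  apply/seteqP; split=> y; rewrite /xsection /= inE /A /= /dot /=.
    move=> E; apply: (mulfI g20).
    by rewrite [RHS]mulrC divfK//; apply/eqP; rewrite -addr_eq0 addrC -addrA E.
  by move=> ->; field.
exact: lebesgue_measure_set1.
Qed.

(** Balls of the product norm are squares, whose measure is a product of positive lengths. *)
Lemma leb2_open_neq0 A : open A -> A !=set0 -> measurable (A : set (lebR2 R)) ->
  leb2 A != 0%E.
Proof.
move=> oA [x Ax] mA.
have /(open_nbhs_nbhs)/nbhs_ballP[e /= e0 eA] : open_nbhs x A by [].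
pose I (r : R) : set R := `]r - e, r + e[%classic.
have IA : I x.1 `*` I x.2 `<=` A.
  move=> y [y1 y2]; apply: eA; split => /=.
    by move: y1; rewrite /I /= in_itv /= -ball_normE /= ltr_distlC.
  by move: y2; rewrite /I /= in_itv /= -ball_normE /= ltr_distlC.
have mI r : measurable (I r) by exact: measurable_itv.
have [mII IE] := leb2_box (mI x.1) (mI x.2).
rewrite gt_eqF//; apply: (@lt_le_trans _ _ (leb2 (I x.1 `*` I x.2))).
  rewrite IE mule_gt0// /I lebesgue_measure_itv /= lte_fin ifT ?lte_fin//; lra.
by apply: le_measure; rewrite ?inE.
Qed.

Lemma leb2_bounded_lty A : bounded_set A -> measurable (A : set (lebR2 R)) ->
  (leb2 A < +oo)%E.
Proof.
move=> [M [_ AM]] mA.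
pose I : set R := `[- (M + 1), M + 1]%classic.
have mI : measurable I by exact: measurable_itv.
have [mII IE] := leb2_box mI mI.
apply: (@le_lt_trans _ _ (leb2 (I `*` I))).
  apply: le_measure; rewrite ?inE// => x Ax.
  have : `|x| <= M + 1 by apply: AM => //; rewrite ltrDl.
  rewrite prod_normE ge_max => /andP[x1 x2].
  by split; rewrite /I /= in_itv /= -ler_norml.
by rewrite IE /I lebesgue_measure_itv /= lte_fin; case: ifP => _;
  rewrite ?mule0 ?ltry// -EFinB -EFinM ltry.
Qed.

Lemma measurable_open_triangle (a : 'I_3 -> R * R) :
  measurable (open_triangle a : set (lebR2 R)).
Proof.
have mP i : measurable (bary a i @^-1` `]0, +oo[ : set (lebR2 R)).
  have [c [g bE]] := bary_affine a i; rewrite (funext bE).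
  by rewrite -[X in measurable X]setTI; exact: measurable_affine.
rewrite (_ : open_triangle a =
    \bigcap_(i in [set: 'I_3]) (bary a i @^-1` `]0, +oo[)).
  by apply: fin_bigcap_measurable.
by apply/seteqP; split=> x ax i; [move=> _|]; have := ax i;
  rewrite /= in_itv/= andbT //; apply.
Qed.

Lemma negligible_triangle_boundary (a : 'I_3 -> R * R) : nondegenerate a ->
  leb2.-negligible (triangle a `\` open_triangle a : set (lebR2 R)).
Proof.
move=> nda; pose N i : set (lebR2 R) := [set x | bary a i x = 0].
have N0 i : leb2.-negligible (N i).
  have [c [g bE]] := bary_affine a i; rewrite /N (funext bE).
  (* A zero gradient would make the coordinate constant, although it is 1 at vertex [i] and 0 at
     vertex [i + 1]. *)
  apply: negligible_line; apply/eqP => g0.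
  have := bE (a i); have := bE (a (i + 1)); rewrite !bary_vertex// eqxx g0 /dot /=.
  rewrite !mul0r addr0 => <- /eqP; apply/negP.
  by case: (ord3P i) => ->; rewrite !ord3_add /= oner_eq0.
apply: (@negligibleS _ _ _ _ (N 0 `|` N 1 `|` N 2)).
  move=> x [/(triangleP _ nda) x0 nx]; apply: contrapT => nN; apply: nx => i.
  rewrite lt0r x0 andbT; apply/eqP => xi0; apply: nN.
  by move: xi0; case: (ord3P i) => -> ?; [left; left|left; right|right].
by apply: negligibleU => //; exact: negligibleU.
Qed.

End Lebesgue2.

(** * Measurability and integrability on the triangulated domain *)

Section Comparison.
Context {R : realType}.

(** The exceptional null set may depend on [s] and [t]. Rational arguments give a single null set,
    and continuity extends the bounds to real arguments, where the strict ones become weak. *)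
Lemma coefficient_bounds_ae (A : set (R * R)) (kappa : R * R -> R -> R)
    (ka kb L : R) :
  {ae leb2, forall x, A x -> continuous (kappa x)} ->
  (forall s, {ae leb2, forall x, A x -> ka < kappa x s < kb}) ->
  (forall s t, {ae leb2, forall x, A x ->
     `|kappa x s - kappa x t| <= L * `|s - t|}) ->
  {ae leb2, forall x, A x -> (forall s, ka <= kappa x s <= kb) /\
     (forall s t, `|kappa x s - kappa x t| <= L * `|s - t|)}.
Proof.
move=> kc kbd kL.
have aq : {ae leb2, forall x (q : rat), A x -> ka < kappa x (ratr q) < kb}.
  by apply: ae_forall_countable => q; exact: kbd.
have aqr : {ae leb2, forall x (qr : rat * rat), A x ->
    `|kappa x (ratr qr.1) - kappa x (ratr qr.2)| <= L * `|ratr qr.1 - ratr qr.2|}.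
  by apply: ae_forall_countable => -[q r]; exact: kL.
apply: filterS3 kc aq aqr => x + + + Ax => /(_ Ax) kc kq kqr.
split=> [s|s t].
  apply/andP; split; rewrite -subr_ge0.
    apply: (@continuous_ge0_rat _ (fun s => kappa x s - ka)) => [r|q].
      by apply: cvgB; [exact: kc|exact: cvg_cst].
    by have /andP[/ltW] := kq q Ax; rewrite subr_ge0.
  apply: (@continuous_ge0_rat _ (fun s => kb - kappa x s)) => [r|q].
    by apply: cvgB; [exact: cvg_cst|exact: kc].
  by have /andP[_ /ltW] := kq q Ax; rewrite subr_ge0.
have cdiff c : continuous (fun s => L * `|s - c| - `|kappa x s - kappa x c|).
  move=> r; apply: cvgB.
    apply: cvgM; first exact: cvg_cst.
    by apply: cvg_norm; apply: cvgB; [exact: cvg_id|exact: cvg_cst].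
  by apply: cvg_norm; apply: cvgB; [exact: kc|exact: cvg_cst].
have symm a b : L * `|a - b| - `|kappa x a - kappa x b| =
    L * `|b - a| - `|kappa x b - kappa x a|.
  by rewrite distrC (distrC (kappa x a)).
(* Density is used in one variable at a time, with [symm] exchanging their roles in between. *)
rewrite -subr_ge0; apply: (continuous_ge0_rat (cdiff t)) => q; rewrite symm.
apply: (continuous_ge0_rat (cdiff (ratr q))) => r.
by rewrite subr_ge0; exact: (kqr (r, q) Ax).
Qed.

Section Mesh.
Variables (n : nat) (T : 'I_n -> 'I_3 -> R * R) (A : set (R * R)).
Hypothesis cT : conforming_triangulation T A.

Lemma measurable_affine_on (u : lebR2 R -> R) k : affine_on (triangle (T k)) u ->
  measurable_fun (open_triangle (T k) : set (lebR2 R)) u.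
Proof.
have [nd _ _] := cT.
move=> [c [g uE]]; apply: (eq_measurable_fun (fun x : lebR2 R => c + dot g x)).
  by move=> x /set_mem Tx; rewrite uE//; apply: open_triangle_sub.
exact: measurable_affine.
Qed.

Lemma affine_on_grad (u : R * R -> R) k : affine_on (triangle (T k)) u ->
  exists g, (forall x, open_triangle (T k) x -> grad u x = g) /\
    (forall i j, dot g (T k i - T k j) = u (T k i) - u (T k j)).
Proof.
have [nd _ _] := cT.
move=> [c [g uE]]; exists g; split=> [x|i j]; first exact: grad_affine uE.
by rewrite !uE; [rewrite /dot /=; ring|exact: triangle_vertex..].
Qed.

Lemma triangle_edge_pt k i s : 0 <= s <= 1 -> triangle (T k) (edge_pt T k i s).
Proof.
have [nd _ _] := cT => s01.
apply/triangleP => // j; have [c' [g' bE]] := bary_affine (T k) j.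
by rewrite bE affine_seg_pt -!bE !bary_vertex// addr_ge0// mulr_ge0//; lra.
Qed.

Lemma affine_on_edge_pt (u : R * R -> R) k i s : affine_on (triangle (T k)) u ->
  0 <= s <= 1 ->
  u (edge_pt T k i s) = (1 - s) * u (T k i) + s * u (T k (i + 1)).
Proof.
move=> [c [g uE]] s01; have te := triangle_edge_pt k i s01.
by rewrite !uE; [exact: affine_seg_pt|exact: triangle_vertex..|].
Qed.

Hypothesis Areg : (closure A)° = A.

(** An open subset of [closure A] lies in its interior, which is [A] by [Areg]. *)
Lemma open_triangle_subset k : open_triangle (T k) `<=` A.
Proof.
have [nd AT _] := cT; rewrite -Areg -open_subsetE; last exact: open_open_triangle.
by rewrite AT => x Tx; exists k => //; apply: open_triangle_sub.
Qed.

Lemma open_triangle_cover_ae :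
  {ae leb2, forall x, A x -> exists k, open_triangle (T k) x}.
Proof.
have [nd AT _] := cT.
have : {ae leb2, forall x k, ~ (triangle (T k) `\` open_triangle (T k)) x}.
  apply: ae_forall_countable => k.
  by apply: negligibleS (negligible_triangle_boundary (nd k)) => x /contrapT.
apply: filterS => x Hx Ax.
have : closure A x by exact: subset_closure.
rewrite AT => -[k _ Tx]; exists k; apply: contrapT => nx; exact: Hx (conj Tx nx).
Qed.

Lemma measurable_triangulated : measurable (A : set (lebR2 R)).
Proof.
apply: (measurable_pieces leb2_complete (F := fun k => open_triangle (T k))).
- exact: countableP.
- by move=> k; exact: measurable_open_triangle.
- exact: open_triangle_subset.
- exact: open_triangle_cover_ae.
Qed.

Lemma measurable_fun_triangulated (f : lebR2 R -> R) :
  (forall k, measurable_fun (open_triangle (T k) : set (lebR2 R)) f) ->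
  measurable_fun (A : set (lebR2 R)) f.
Proof.
apply: (measurable_fun_pieces leb2_complete (F := fun k => open_triangle (T k))).
- exact: countableP.
- by move=> k; exact: measurable_open_triangle.
- exact: open_triangle_subset.
- exact: open_triangle_cover_ae.
Qed.

Hypothesis bA : bounded_set A.

Lemma integrable_flux (kappa : R * R -> R -> R) (ka kb : R) u v :
  caratheodory_function A kappa ->
  {ae leb2, forall x, A x -> forall s, ka <= kappa x s <= kb} -> 0 < ka ->
  (forall k, affine_on (triangle (T k)) u) ->
  (forall k, affine_on (triangle (T k)) v) ->
  leb2.-integrable (A : set (lebR2 R))
    (fun x : lebR2 R => (kappa x (u x) * dot (grad u x) (grad v x))%:E).
Proof.
move=> [km kc] kbd ka0 au av.
have mA := measurable_triangulated.
have /choice[gu guE] k := affine_on_grad (au k).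
have /choice[gv gvE] k := affine_on_grad (av k).
have mF : measurable_fun (A : set (lebR2 R))
    (fun x : lebR2 R => kappa x (u x) * dot (grad u x) (grad v x)).
  apply: measurable_fun_triangulated => k.
  have mT := measurable_open_triangle (T k).
  apply: (eq_measurable_fun
    (fun x : lebR2 R => kappa x (u x) * dot (gu k) (gv k))).
    by move=> x /set_mem Tx; rewrite (guE k).1// (gvE k).1.
  apply: measurable_fun_mulr_cst.
  have kT s : measurable_fun (open_triangle (T k) : set (lebR2 R))
      (kappa ^~ s : lebR2 R -> R).
    by apply: (measurable_funS mA (@open_triangle_subset k)); exact: km.
  have cT' : {ae leb2, forall x, open_triangle (T k) x -> continuous (kappa x)}.
    by apply: filterS kc => x kx Tx; apply: kx; exact: open_triangle_subset Tx.
  exact: (measurable_fun_caratheodory leb2_complete mT kT cT'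
    (measurable_affine_on (au k))).
(* The sum over all triangles bounds each single constant product of gradients. *)
pose B := \sum_k `|dot (gu k) (gv k)|.
apply: (ae_bounded_integrable (B := `|kb| * B) mA (leb2_bounded_lty bA mA) mF).
  by rewrite mulr_ge0// sumr_ge0.
apply: filterS2 kbd open_triangle_cover_ae => x + + Ax => /(_ Ax) kx /(_ Ax) [k Tx].
rewrite normrM ler_pM//.
  have /andP[k1 k2] := kx (u x).
  by apply: le_trans (ler_norm kb); rewrite ger0_norm// (le_trans (ltW ka0)).
by rewrite (guE k).1// (gvE k).1// /B (bigD1 k)//= lerDl sumr_ge0.
Qed.

Lemma integrable_source (f v : R * R -> R) : L2 A f ->
  (forall k, affine_on (triangle (T k)) v) -> (forall x, A x -> `|v x| <= 1) ->
  leb2.-integrable (A : set (lebR2 R)) (fun x : lebR2 R => (f x * v x)%:E).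
Proof.
move=> fL2 av v1.
have mA := measurable_triangulated.
have mv : measurable_fun (A : set (lebR2 R)) (v : lebR2 R -> R).
  by apply: measurable_fun_triangulated => k; exact: measurable_affine_on.
exact: (Lfun2_bounded_integrable mA (leb2_bounded_lty bA mA) fL2 mv v1).
Qed.

End Mesh.
End Comparison.

(** * The test function built from the signs of [w] at the nodes *)

Section Comparison.
Context {R : realType}.
Variables (n : nat) (T : 'I_n -> 'I_3 -> R * R) (A : set (R * R)).
Hypothesis cT : conforming_triangulation T A.

Definition positive_nodes (w : R * R -> R) : R * R -> R :=
  nodal_interp T (fun x => (0 < w x)%R%:R).

Lemma positive_nodes_itv w x : closure A x -> 0 <= positive_nodes w x <= 1.
Proof.
have [nd AT _] := cT; rewrite AT => -[k _ Tx].
rewrite /positive_nodes (nodal_interpE cT _ Tx) /bary_interp.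
have b0 := (triangleP x (nd k)).1 Tx; apply/andP; split.
  by apply: sumr_ge0 => i _; rewrite mulr_ge0.
rewrite -[leRHS](sum_bary x (nd k)); apply: ler_sum => i _.
by rewrite ler_piMr ?b0 //=; case: (0 < w _)%R; rewrite ?lexx ?ler01.
Qed.

Lemma positive_nodes_V0D (GD : set (R * R)) w : captures T GD ->
  (forall k, affine_on (triangle (T k)) w) -> (forall x, GD x -> w x = 0) ->
  V0D T A GD (positive_nodes w).
Proof.
move=> capt aw w0; split.
- exact: nodal_interp_continuous.
- by move=> k; exact: (nodal_interp_affine cT).
move=> x Gx; have [k [i [[s s01 <-] sub]]] := capt x Gx.
(* Capture only places the open edge in [GD], so [w] is known to vanish at its inner points; the
   points 1/2 and 1/4 then give two independent equations for the endpoint values. *)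
have w0s r : 0 < r < 1 -> (1 - r) * w (T k i) + r * w (T k (i + 1)) = 0.
  move=> r01; rewrite -(affine_on_edge_pt cT i (aw k)); last by lra.
  by apply/w0/sub; exists r => //=; rewrite in_itv.
have wi : w (T k i) = 0.
  by have := w0s 2^-1 ltac:(lra); have := w0s 4^-1 ltac:(lra); lra.
have wj : w (T k (i + 1)) = 0.
  by have := w0s 2^-1 ltac:(lra); have := w0s 4^-1 ltac:(lra); lra.
have s01' : 0 <= s <= 1 by move: s01; rewrite /= in_itv.
rewrite /positive_nodes -/(edge_pt T k i s).
rewrite (affine_on_edge_pt cT i (nodal_interp_affine cT _ k) s01').
by rewrite !(nodal_interp_vertex cT) wi wj ltxx !mulr0 addr0.
Qed.

Lemma arc_integral_set0 (g : R * R -> \bar R) : arc_integral T A set0 g = 0%E.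
Proof.
rewrite /arc_integral big1// => k _; rewrite big1// => i _.
by rewrite patch_set0 integral0 mule0.
Qed.

End Comparison.

(** * Comparison of the two discrete solutions *)

Unset Implicit Arguments.

Theorem theorem3p4 (R : realType) (Omega GammaD GammaN : set (R * R))
    (n : nat) (T : 'I_n -> 'I_3 -> R * R) (tmin tmax : R)
    (kappa : R * R -> R -> R) (ka kb L0 : R)
    (f1 f2 psi u1 u2 : R * R -> R) :
  polygonal_domain Omega ->
  GammaD `<=` boundary Omega ->
  GammaN = boundary Omega `\` GammaD ->
  conforming_triangulation T Omega ->
  captures T (boundary Omega) -> captures T GammaD -> captures T GammaN ->
  (0 < arc_integral T Omega GammaD (cst 1%E))%E ->
  0 < tmin -> tmin < tmax -> tmax < pi / 2 ->
  (forall k i, tmin <= angle (T k) i <= tmax) ->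
  caratheodory_function Omega kappa ->
  0 < ka -> ka < kb -> 0 < L0 ->
  (forall s, {ae leb2, forall x, Omega x -> ka < kappa x s < kb}) ->
  (forall s t, {ae leb2, forall x, Omega x ->
     `|kappa x s - kappa x t| <= L0 * `|s - t|}) ->
  L2 Omega f1 -> L2 Omega f2 ->
  {ae leb2, forall x, Omega x -> f1 x <= f2 x} ->
  H12 T Omega GammaN psi ->
  discrete_solution T Omega GammaD GammaN kappa f1 psi u1 ->
  discrete_solution T Omega GammaD GammaN kappa f2 psi u2 ->
  (forall k, (gammaT (T k))^-1 * (1 + (gammaT (T k))^-1) * max_jump (T k) u2
             < 6 * ka * cT (T k) / (7 * L0)) ->
  forall x, Omega x -> u1 x <= u2 x.
Proof.
move=> [_ bO conO regO _] _ _ cT _ captD _ GD0 _ _ _ _ [km kc] ka0 kab L00 kbd kL.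
move=> fL1 fL2 f12 _ [[cu1 au1 u10] E1] [[cu2 au2 u20] E2] mesh.
have [nd OT _] := cT.
pose w x := u1 x - u2 x.
have aw k : affine_on (triangle (T k)) w.
  have [c1 [g1 e1]] := au1 k; have [c2 [g2 e2]] := au2 k.
  exists (c1 - c2), (g1 - g2) => x Tx.
  by rewrite /w e1// e2// /dot /=; ring.
have w0 x : GammaD x -> w x = 0 by move=> Gx; rewrite /w u10// u20// subrr.
pose v := positive_nodes T w.
have [cv av v0] : V0D T Omega GammaD v := positive_nodes_V0D cT captD aw w0.
have vvertex k i : v (T k i) = (0 < w (T k i))%R%:R
  by exact: (nodal_interp_vertex cT).
have v01 x : Omega x -> 0 <= v x <= 1.
  by move=> Ox; exact: (positive_nodes_itv cT w (subset_closure Ox)).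
have mO := measurable_triangulated cT regO.
have kae := coefficient_bounds_ae kc kbd kL.
have kbnd : {ae leb2, forall x, Omega x -> forall s, ka <= kappa x s <= kb}.
  by apply: filterS kae => x H /H[].
pose F (u : R * R -> R) x := kappa x (u x) * dot (grad u x) (grad v x).
have IF u : (forall k, affine_on (triangle (T k)) u) ->
    leb2.-integrable (Omega : set (lebR2 R)) (EFin \o (F u : lebR2 R -> R)).
  by move=> au; exact: (integrable_flux cT regO bO (conj km kc) kbnd ka0 au av).
have Ifv f : L2 Omega f ->
    leb2.-integrable (Omega : set (lebR2 R))
      (EFin \o (fun x : lebR2 R => f x * v x)).
  move=> fL; apply: (integrable_source cT regO bO fL av) => x /v01/andP[vx0 vx1].
  by rewrite ger0_norm.
(* The difference of the two tested equations, arranged as a sum of two terms that are nonnegative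
   almost everywhere. *)
pose G x := (F u1 x - F u2 x) + (f2 x * v x - f1 x * v x).
have IG1 : leb2.-integrable (Omega : set (lebR2 R))
    (EFin \o (fun x : lebR2 R => F u1 x - F u2 x)).
  exact: (integrableB mO (IF _ au1) (IF _ au2)).
have IG2 : leb2.-integrable (Omega : set (lebR2 R))
    (EFin \o (fun x : lebR2 R => f2 x * v x - f1 x * v x)).
  exact: (integrableB mO (Ifv _ fL2) (Ifv _ fL1)).
have IG : leb2.-integrable (Omega : set (lebR2 R)) (EFin \o (G : lebR2 R -> R)).
  exact: (integrableD mO IG1 IG2).
have G0 : \int[leb2]_(x in (Omega : set (lebR2 R))) G x = 0.
  rewrite /G (RintegralD mO IG1 IG2) (RintegralB mO (IF _ au1) (IF _ au2)).
  rewrite (RintegralB mO (Ifv _ fL2) (Ifv _ fL1)).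
  have := E1 _ (And3 cv av v0); have := E2 _ (And3 cv av v0).
  rewrite -/v /F => -> ->; ring.
pose mixed k := exists i j, (0 < w (T k i)) != (0 < w (T k j)).
have flux k x : open_triangle (T k) x -> Omega x ->
    (forall s, ka <= kappa x s <= kb) /\
      (forall s t, `|kappa x s - kappa x t| <= L0 * `|s - t|) ->
    (mixed k -> 0 < F u1 x - F u2 x) /\ 0 <= F u1 x - F u2 x.
  move=> Tx Ox [kx kLx].
  have [g1 [g1E g1d]] := affine_on_grad cT (au1 k).
  have [g2 [g2E g2d]] := affine_on_grad cT (au2 k).
  have [gv [gvE gvd]] := affine_on_grad cT (av k).
  have pos : mixed k -> 0 < F u1 x - F u2 x.
    move=> mk; rewrite /F g1E// g2E// gvE//.
    have := @flux_difference_gt0 _ (T k) u2 (w \o T k) ka L0 (kappa x (u1 x))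
      (kappa x (u1 x) - kappa x (u2 x)) (g1 - g2) g2 gv (nd k) ka0 L00 (mesh k).
    (* The flux difference splits into the coefficient at [u1] times the gradient of [w], plus the
       coefficient difference times the gradient of [u2]. *)
    rewrite (_ : _ * dot (g1 - g2) gv + _ = kappa x (u1 x) * dot g1 gv -
      kappa x (u2 x) * dot g2 gv); last by rewrite /dot /=; ring.
    apply => //.
    - move=> i j; rewrite /w /= opprB addrACA -opprB.
      have := g1d i j; have := g2d i j; rewrite /dot /=; clear; lra.
    - by move=> i j; rewrite gvd !vvertex.
    - by have /andP[] := kx (u1 x).
    move=> B WB; apply: le_trans (kLx _ _) _; rewrite ler_wpM2l ?(ltW L00)//.
    rewrite -/(w x) (affine_on_bary (nd k) (aw k) (open_triangle_sub (nd k) Tx)).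
    apply: le_trans (ler_norm_sum _ _ _) _.
    rewrite -[B]mul1r -(sum_bary x (nd k)) mulr_suml; apply: ler_sum => i _.
    rewrite normrM (ger0_norm (ltW (Tx i))).
    exact: ler_wpM2l (ltW (Tx i)) _ _ (WB i).
  split=> //; have [/pos/ltW//|nm] := pselect (mixed k).
  have V i j : v (T k i) = v (T k j).
    rewrite !vvertex; congr (_%:R); congr nat_of_bool; apply/eqP.
    apply: contrapT => /negP ij.
    by apply: nm; exists i, j.
  (* On an unmixed triangle the increments of [v] along two independent edges vanish, hence so does
     its gradient. *)
  have gv0 g : dot g gv = 0.
    have gvb i j : dot gv (T k i - T k j) = 0 by rewrite gvd (V i j) subrr.
    apply: (mulfI (expf_neq0 2 (nondegenerateP (nd k)))).
    by rewrite (dot_const_edges g (gvb 1 0) (gvb 2 0)) mul0r mulr0.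
  by rewrite /F gvE// !gv0 !mulr0 subrr.
have Gge0 : {ae leb2, forall x, Omega x -> 0 <= G x}.
  have cov := open_triangle_cover_ae cT.
  apply: filterS3 kae f12 cov => x + + + Ox.
  move=> /(_ Ox) kx /(_ Ox) fx /(_ Ox) [k Tx].
  have [_ F0] := flux k x Tx Ox kx.
  rewrite /G addr_ge0// -mulrBl mulr_ge0 ?subr_ge0//.
  by have /andP[] := v01 x Ox.
(* On a mixed triangle [G] would be positive on an open set of nonzero measure, while its integral
   is 0. *)
have nomix k : ~ mixed k.
  move=> mk.
  have := Rintegral_gt0 mO IG Gge0 (open_triangle_subset cT regO (k := k))
    (measurable_open_triangle (T k))
    (leb2_open_neq0 (@open_open_triangle _ (T k)) (open_triangle_nonempty (nd k))
       (measurable_open_triangle (T k))).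
  rewrite G0 ltxx => H; apply: notF; apply: H.
  apply: filterS2 kae f12 => x + + Tx.
  have Ox := open_triangle_subset cT regO Tx.
  move=> /(_ Ox) kx /(_ Ox) fx.
  have [/(_ mk) F0 _] := flux k x Tx Ox kx.
  rewrite /G ltr_wpDr// -mulrBl mulr_ge0 ?subr_ge0//.
  by have /andP[] := v01 x Ox.
have vertices_agree k i j : (0 < w (T k i)) = (0 < w (T k j)).
  apply/eqP; apply: contrapT => /negP ij; apply: (nomix k); by exists i, j.
have vconst k x i : triangle (T k) x -> v x = v (T k i).
  move=> Tx; rewrite (affine_on_bary (nd k) (av k) Tx).
  rewrite -[RHS]mul1r -(sum_bary x (nd k)) mulr_suml; apply: eq_bigr => j _.
  by rewrite !vvertex (vertices_agree k i j).
have vT0 : (forall x, Omega x -> v x = 0) \/ (forall x, Omega x -> v x = 1).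
  apply: connected_01_constant => //.
    exact: continuous_subspaceW (@subset_closure _ Omega) cv.
  move=> x Ox; have : closure Omega x by exact: subset_closure.
  rewrite OT => -[k _ Tx]; rewrite (vconst k x 0 Tx) vvertex.
  by case: (0 < _)%R; [right|left].
have {}vT0 x : Omega x -> v x = 0.
  case: vT0 => [vT0|vT1] Ox; first exact: vT0.
  (* A Dirichlet part of positive length contains a point [z]; [v] vanishes there, hence on a whole
     triangle meeting [Omega], which excludes the value 1. *)
  have [z Gz] : GammaD !=set0.
    apply/set0P; apply: contraTN GD0 => /eqP ->.
    by rewrite arc_integral_set0 ltxx.
  have [k [i [ez _]]] := captD z Gz.
  have [c oc] := open_triangle_nonempty (nd k).
  have ze : triangle (T k) z.
    case: ez => s s01 <-; apply: (triangle_edge_pt cT).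
    by move: s01; rewrite /= in_itv.
  have := vT1 c (open_triangle_subset cT regO oc).
  rewrite (vconst k c 0 (open_triangle_sub (nd k) oc)) -(vconst k z 0 ze) v0//.
  by move/eqP; rewrite eq_sym oner_eq0.
move=> x Ox; have : closure Omega x by exact: subset_closure.
rewrite OT => -[k _ Tx].
(* [w x] is a convex combination of nodal values, and a positive one among them would give
   [v x = 1]. *)
rewrite -subr_le0 -/(w x) (affine_on_bary (nd k) (aw k) Tx).
rewrite -oppr_ge0 -sumrN; apply: sumr_ge0 => i _.
rewrite -mulrN mulr_ge0//; first exact: (triangleP x (nd k)).1.
rewrite oppr_ge0 leNgt; apply/negP => wi.
have := vT0 x Ox; rewrite (vconst k x i Tx) vvertex wi /=.
by move/eqP; rewrite oner_eq0.
Qed.
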